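(* Let $N\ge 2$, let $a,b,p,q>0$ and $s\ge 1$. The system $$\Delta u=|x|^{a}v^{p}\ \text{ in } \mathbb{R}^N,\qquad \Delta v=|x|^{b}v^{q}|\nabla u|^{s}\ \text{ in } \mathbb{R}^N$$ has positive radial solutions $(u,v)$ if and only if $$ps+q-1\le 0 .$$
   Context: A positive radial solution is a pair $(u,v)$ of positive, radially symmetric, classical ($C^2$) functions on $\mathbb{R}^N$ satisfying the system pointwise. *)

(* Defs.v *)
From HB Require Import structures.
From mathcomp Require Import all_boot all_order all_algebra.
From mathcomp Require Import all_classical all_reals all_analysis.
Import Order.TTheory GRing.Theory Num.Theory.
Import numFieldNormedType.Exports.

Set Implicit Arguments.
Unset Strict Implicit.
Unset Printing Implicit Defensive.

Local Open Scope classical_set_scope.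
Local Open Scope ring_scope.

(* The library norm `|x| on 'rV[R]_N is the sup norm; it induces the usual
   topology, but |x| and |grad u| in the system are Euclidean norms. *)
Definition enorm (R : realType) (N : nat) (x : 'rV[R]_N) : R :=
  Num.sqrt (\sum_(i < N) x 0 i ^+ 2).

(* 'D_v f x is a junk value where f is not derivable; existence of the partial
   derivatives is required separately, in [C2]. *)
Definition partial (R : realType) (N : nat) (i : 'I_N) (f : 'rV[R]_N -> R) :
    'rV[R]_N -> R :=
  fun x => 'D_(delta_mx 0 i) f x.

Definition has_partials (R : realType) (N : nat) (f : 'rV[R]_N -> R) : Prop :=
  forall (i : 'I_N) (x : 'rV[R]_N), derivable f x (delta_mx 0 i).

Definition C1 (R : realType) (N : nat) (f : 'rV[R]_N -> R) : Prop :=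
  [/\ continuous f, has_partials f & forall i : 'I_N, continuous (partial i f)].

Definition C2 (R : realType) (N : nat) (f : 'rV[R]_N -> R) : Prop :=
  C1 f /\ forall i : 'I_N, C1 (partial i f).

Definition grad (R : realType) (N : nat) (f : 'rV[R]_N -> R) (x : 'rV[R]_N) :
    'rV[R]_N :=
  \row_(i < N) partial i f x.

Definition laplacian (R : realType) (N : nat) (f : 'rV[R]_N -> R)
    (x : 'rV[R]_N) : R :=
  \sum_(i < N) partial i (partial i f) x.

Definition radial (R : realType) (N : nat) (f : 'rV[R]_N -> R) : Prop :=
  forall x y : 'rV[R]_N, enorm x = enorm y -> f x = f y.

(* In MathComp-Analysis 0 `^ r = 0 for r != 0, which is the right value of the
   powers at x = 0 and at critical points of u since a, b and s are positive. *)
Definition solves_system (R : realType) (N : nat) (a b p q s : R)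
    (u v : 'rV[R]_N -> R) : Prop :=
  forall x : 'rV[R]_N,
    laplacian u x = enorm x `^ a * v x `^ p /\
    laplacian v x = enorm x `^ b * v x `^ q * enorm (grad u x) `^ s.

Definition positive_radial_solution (R : realType) (N : nat) (a b p q s : R)
    (u v : 'rV[R]_N -> R) : Prop :=
  [/\ C2 u /\ C2 v,
      (forall x, 0 < u x) /\ (forall x, 0 < v x),
      radial u /\ radial v
    & solves_system a b p q s u v].

(* Main.v *)
(** In the radial variable [r] the system reads [(r^n u')' = r^(n + a) v^p] and
    [(r^n v')' = r^(n + b) v^q |u'|^s] with [n = N - 1].

    If [p s + q > 1], integrating three times over consecutive intervals of
    length [h] contained in [[A, 2 A]], [A >= 1], gives
    [v (r + 3 h) >= v r + c h^(2 + s) (v r)^(p s + q)] with [c] independent of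
    [A].  Steps [h_k] in geometric progression then double [v] at each step, and
    their sum stays below [A] when [A] is large: [v] is unbounded on [[A, 2 A]].

    If [p s + q <= 1], the integral operator [Phi] whose fixed points are the
    solutions [v] with [v 0 = 1] is monotone and, for
    [m = b + s (a + 1) + 1], maps the nondecreasing functions between [1] and
    [exp (r^(m + 1) / (m + 1))] to themselves.  Monotone functions are
    measurable, so the Knaster-Tarski argument applies, without any passage to
    the limit under the integral, and the fixed point is then of class [C2] by
    bootstrapping. *)

Require Import Defs.
From mathcomp Require Import all_boot all_order all_algebra.
From mathcomp Require Import all_classical all_reals all_analysis.
From mathcomp Require Import measurable_realfun ring lra.
Import Order.TTheory GRing.Theory Num.Theory.
Import numFieldNormedType.Exports.

Set Implicit Arguments.
Unset Strict Implicit.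
Unset Printing Implicit Defensive.

Local Open Scope classical_set_scope.
Local Open Scope ring_scope.

(** * Partial derivatives of functions of the Euclidean norm *)

Lemma is_derive_line (R : realType) (V : normedModType R) (f : V -> R)
    (x v : V) (df : R) :
  is_derive (0 : R) 1 (fun h : R => f (h *: v + x)) df -> is_derive x v f df.
Proof.
move=> [dfx dfE]; apply: DeriveDef; first by apply/derivable1P.
rewrite -dfE /derive.
set g1 := fun h => h^-1 *: _; set g2 := fun h => h^-1 *: _.
suff -> : g1 = g2 by [].
by rewrite funeqE /g1 /g2 => h /=; rewrite addr0 scale0r add0r [_%:A]mulr1.
Qed.

Lemma sum_sqr_ge0 (R : realType) (N : nat) (x : 'rV[R]_N) :
  0 <= \sum_(i < N) x 0 i ^+ 2.
Proof. by apply: sumr_ge0 => i _; exact: sqr_ge0. Qed.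

Lemma enorm_ge0 (R : realType) (N : nat) (x : 'rV[R]_N) : 0 <= enorm x.
Proof. exact: sqrtr_ge0. Qed.

Lemma sqr_enorm (R : realType) (N : nat) (x : 'rV[R]_N) :
  enorm x ^+ 2 = \sum_(i < N) x 0 i ^+ 2.
Proof. by rewrite sqr_sqrtr// sum_sqr_ge0. Qed.

Lemma enorm_coord_le (R : realType) (N : nat) (x : 'rV[R]_N) i :
  `|x 0 i| <= enorm x.
Proof.
rewrite -sqrtr_sqr ler_wsqrtr// (bigD1 i)//= lerDl.
by apply: sumr_ge0 => j _; exact: sqr_ge0.
Qed.

Lemma enormZ (R : realType) (N : nat) (k : R) (x : 'rV[R]_N) :
  enorm (k *: x) = `|k| * enorm x.
Proof.
rewrite -sqrtr_sqr -sqrtrM ?sqr_ge0// /enorm mulr_sumr; congr Num.sqrt.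
by apply: eq_bigr => i _; rewrite mxE exprMn.
Qed.

Lemma enorm_delta (R : realType) (N : nat) (i : 'I_N) :
  enorm (delta_mx 0 i : 'rV[R]_N) = 1.
Proof.
rewrite /enorm (bigD1 i)//= mxE !eqxx expr1n big1 ?addr0 ?sqrtr1// => j ji.
by rewrite mxE (negbTE ji) expr0n.
Qed.

Lemma enorm0 (R : realType) (N : nat) : enorm (0 : 'rV[R]_N) = 0.
Proof. by rewrite -(scale0r 0) enormZ normr0 mul0r. Qed.

Lemma sqr_enorm_line (R : realType) (N : nat) (x : 'rV[R]_N) i (h : R) :
  enorm (h *: delta_mx 0 i + x) ^+ 2 = enorm x ^+ 2 + 2 * h * x 0 i + h ^+ 2.
Proof.
rewrite !sqr_enorm (bigD1 i)//= [in RHS](bigD1 i)//= !mxE !eqxx.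
under eq_bigr => j ji do rewrite !mxE (negbTE ji) andbF mulr0 add0r.
by rewrite /=; ring.
Qed.

Lemma continuous_enorm (R : realType) (N : nat) :
  continuous (@enorm R N).
Proof.
move=> x; apply: (@continuous_comp _ _ _
  (fun y : 'rV[R]_N => \sum_(i < N) y 0 i ^+ 2) Num.sqrt);
  last exact: sqrt_continuous.
move: x; apply: continuous_big => [|i _ x]; first exact: add_continuous.
by apply: (@continuous_comp _ _ _ (fun y : 'rV[R]_N => y 0 i)
  (fun t => t ^+ 2)); [exact: coord_continuous|exact: exprn_continuous].
Qed.

(** Along a coordinate line the squared norm is a quadratic polynomial in [h], so the chain rule
    through the square root applies; [enorm x != 0] keeps it off the singularity. *)
Lemma is_derive_radial (R : realType) (N : nat) (phi : R -> R)
    (x : 'rV[R]_N) (i : 'I_N) (d : R) :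
  enorm x != 0 -> is_derive (enorm x) 1 phi d ->
  is_derive x (delta_mx 0 i) (fun y => phi (enorm y)) (d * (x 0 i / enorm x)).
Proof.
move=> x0 dphi; apply: is_derive_line.
have -> : (fun h : R => phi (enorm (h *: delta_mx 0 i + x))) =
    phi \o (fun h => Num.sqrt (enorm x ^+ 2 + 2 * h * x 0 i + h ^+ 2)).
  apply/funext => h /=.
  by rewrite -sqr_enorm_line sqrtr_sqr ger0_norm ?enorm_ge0.
have e0 : enorm x ^+ 2 + 2 * 0 * x 0 i + 0 ^+ 2 = enorm x ^+ 2 by ring.
apply: is_derive1_comp.
  by rewrite e0 sqrtr_sqr ger0_norm ?enorm_ge0.
have -> : (fun h => Num.sqrt (enorm x ^+ 2 + 2 * h * x 0 i + h ^+ 2)) =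
    Num.sqrt \o (fun h => enorm x ^+ 2 + 2 * h * x 0 i + h ^+ 2) by [].
have -> : x 0 i / enorm x = (2 * Num.sqrt (enorm x ^+ 2))^-1 * (2 * x 0 i).
  by rewrite sqrtr_sqr ger0_norm ?enorm_ge0//; field.
apply: is_derive1_comp.
  by rewrite e0; apply: is_derive1_sqrt; rewrite exprn_gt0// lt0r x0 enorm_ge0.
apply: is_derive_eq.
by rewrite /GRing.scale/=; ring.
Qed.

Lemma is_derive_coord (R : realType) (N : nat) (x : 'rV[R]_N) (i j : 'I_N) :
  is_derive x (delta_mx 0 j) (fun y : 'rV[R]_N => y 0 i) (i == j)%:R.
Proof.
apply: is_derive_line.
have -> : (fun h : R => (h *: delta_mx 0 j + x) 0 i) =
    (fun h => h * (i == j)%:R + x 0 i).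
  by apply/funext => h; rewrite !mxE eqxx.
by apply: is_derive_eq; rewrite /GRing.scale/=; ring.
Qed.

(** The value is the entry [(i, j)] of [(w/r) I + (d - w/r) x x^T / r^2], the Hessian of a radial
    function with radial derivative [w]. *)
Lemma is_derive_radial_grad (R : realType) (N : nat) (w : R -> R)
    (x : 'rV[R]_N) (i j : 'I_N) (d : R) :
  enorm x != 0 -> is_derive (enorm x) 1 w d ->
  is_derive x (delta_mx 0 j) (fun y => y 0 i * (w (enorm y) / enorm y))
    ((i == j)%:R * (w (enorm x) / enorm x) +
     (x 0 i / enorm x) * (x 0 j / enorm x) * (d - w (enorm x) / enorm x)).
Proof.
move=> x0 dw.
have dq : is_derive (enorm x) 1 (fun r => w r / r)
    (d / enorm x - w (enorm x) / enorm x ^+ 2).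
  have dV : is_derive (enorm x) 1 (fun r : R => r^-1) (- enorm x ^- 2).
    apply: is_derive_eq; first exact: is_deriveV.
    by rewrite /GRing.scale/= mulr1.
  apply: is_derive_eq.
  by rewrite /GRing.scale/=; field.
have dg := is_derive_radial j x0 dq.
have di := is_derive_coord x i j.
apply: is_derive_eq.
by rewrite /GRing.scale/=; field.
Qed.

Lemma enorm_gt0 (R : realType) (N : nat) (x : 'rV[R]_N) :
  enorm x != 0 -> 0 < enorm x.
Proof. by move=> x0; rewrite lt0r x0 enorm_ge0. Qed.

Lemma near_enorm_neq0 (R : realType) (N : nat) (x : 'rV[R]_N) :
  enorm x != 0 -> \forall y \near x, enorm y != 0.
Proof.
move=> /enorm_gt0 x0; near=> y; apply: lt0r_neq0.
by near: y; exact: (cvgr_gt (enorm x) (@continuous_enorm R N x)).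
Unshelve. all: by end_near. Qed.

(** * Gradient, Hessian and Laplacian away from the origin *)

Section radial_derivatives.
Context {R : realType} {N : nat}.
Variables (U w w1 : R -> R).
Hypothesis dU : forall r : R, 0 < r -> is_derive r 1 U (w r).
Hypothesis dw : forall r : R, 0 < r -> is_derive r 1 w (w1 r).
Implicit Types x y : 'rV[R]_N.

Let u x := U (enorm x).
Let g r := w r / r.
Let hess i j x := (i == j)%:R * g (enorm x) +
  (x 0 i / enorm x) * (x 0 j / enorm x) * (w1 (enorm x) - g (enorm x)).

Lemma is_derive_radial_fun x i : enorm x != 0 ->
  is_derive x (delta_mx 0 i) u (x 0 i * (w (enorm x) / enorm x)).
Proof.
move=> x0; apply: is_derive_eq.
  by apply: is_derive_radial => //; exact/dU/enorm_gt0.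
by rewrite mulrCA.
Qed.

Lemma is_derive_partial_radial x i j : enorm x != 0 ->
  is_derive x (delta_mx 0 j) (partial i u) (hess i j x).
Proof.
move=> x0.
apply: (@near_eq_is_derive _ _ _ (fun y => y 0 i * (w (enorm y) / enorm y))).
  near=> y; rewrite /partial; apply/esym.
  have y0 : enorm y != 0 by near: y; exact: near_enorm_neq0.
  by have /@derive_val := is_derive_radial_fun i y0.
by apply: is_derive_radial_grad => //; exact/dw/enorm_gt0.
Unshelve. all: by end_near. Qed.

Lemma laplacian_radial x : enorm x != 0 ->
  laplacian u x = w1 (enorm x) + (N%:R - 1) * (w (enorm x) / enorm x).
Proof.
move=> x0; rewrite /laplacian.
under eq_bigr => i _.
  have /@derive_val dE := is_derive_partial_radial i i x0.
  rewrite /partial dE /hess eqxx mul1r.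
  over.
rewrite big_split/= sumr_const card_ord -mulr_suml.
(* The projection onto the unit vector [x / enorm x] has trace 1. *)
have -> : \sum_(i < N) x 0 i / enorm x * (x 0 i / enorm x) = 1.
  under eq_bigr => i _ do rewrite mulf_div -!expr2.
  by rewrite -mulr_suml -sqr_enorm divff// expf_eq0.
by rewrite -mulr_natl /g; ring.
Qed.

Lemma enorm_grad_radial x : enorm x != 0 ->
  enorm (grad u x) = `|w (enorm x)|.
Proof.
move=> x0.
have -> : grad u x = (w (enorm x) / enorm x) *: x.
  apply/rowP => i; rewrite !mxE /partial.
  by have /@derive_val -> := is_derive_radial_fun i x0; rewrite mulrC.
by rewrite enormZ normrM normfV (ger0_norm (enorm_ge0 x)) divfK.
Qed.

End radial_derivatives.

(** * Limits and derivatives at the origin *)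

Lemma cvg_at_right_comp (R : realType) (T : Type) (F : set_system T)
    (FF : Filter F) (f : T -> R) (psi : R -> R) (l : R) :
  f @ F --> 0 -> (\forall x \near F, 0 < f x) -> psi @ 0^'+ --> l ->
  psi (f x) @[x --> F] --> l.
Proof.
move=> f0 fgt0 psil; apply: cvg_comp psil => A A0.
rewrite /nbhs/= /filter_from/=.
by apply: filterS2 fgt0 (f0 _ A0) => x fx0; apply.
Qed.

Lemma cvg0_le_norm (R : realType) (T : Type) (F : set_system T)
    (FF : Filter F) (f h : T -> R) :
  h @ F --> 0 -> (\forall x \near F, `|f x| <= h x) -> f @ F --> 0.
Proof.
move=> h0 fh; apply: norm_cvg0.
apply: (squeeze_cvgr _ (cvg_cst 0) h0).
by apply: filterS fh => x ->; rewrite normr_ge0.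
Qed.

Lemma enorm_eq0 (R : realType) (N : nat) (x : 'rV[R]_N) :
  (enorm x == 0) = (x == 0).
Proof.
apply/eqP/eqP => [x0|->]; last exact: enorm0.
apply/rowP => i; rewrite mxE; apply/eqP.
by rewrite -normr_le0 -x0 enorm_coord_le.
Qed.

Lemma cvg_radial0 (R : realType) (N : nat) (psi : R -> R) :
  psi @ 0^'+ --> 0 -> psi (enorm x) @[x --> (0 : 'rV[R]_N)^'] --> 0.
Proof.
apply: cvg_at_right_comp.
  by have /continuous_withinNx := @continuous_enorm R N 0; rewrite enorm0.
near=> x; rewrite lt0r enorm_ge0 andbT enorm_eq0.
by near: x; exact: nbhs_dnbhs_neq.
Unshelve. all: by end_near. Qed.

(** The difference quotient at 0 is dominated by [psi |h|]. This replaces the chain rule at the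
    origin, where the Euclidean norm is not differentiable. *)
Lemma is_derive0_bound (R : realType) (f psi : R -> R) :
  psi @ 0^'+ --> 0 -> (forall h, h != 0 -> `|f h - f 0| <= `|h| * psi `|h|) ->
  is_derive (0 : R) 1 f 0.
Proof.
move=> psi0 fpsi.
have c0 : h^-1 *: (f (h *: 1 + 0) - f 0) @[h --> 0^'] --> 0.
  apply: (@cvg0_le_norm _ _ _ _ _ (fun h => psi `|h|)).
    apply: cvg_at_right_comp psi0.
      by have /continuous_withinNx := @norm_continuous _ R 0; rewrite normr0.
    near=> h; rewrite normr_gt0.
    by near: h; exact: nbhs_dnbhs_neq.
  near=> h; have h0 : h != 0 by near: h; exact: nbhs_dnbhs_neq.
  rewrite addr0 [_%:A]mulr1 normrM normfV ler_pdivrMl ?normr_gt0//.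
  exact: fpsi.
apply: DeriveDef; first by apply/cvg_ex; exists 0.
exact/cvg_lim.
Unshelve. all: by end_near. Qed.

Lemma derive_continuous_at (R : realType) (f : R -> R) (r d : R) :
  is_derive r 1 f d -> {for r, continuous f}.
Proof. by move=> [/derivable1_diffP/differentiable_continuous]. Qed.

Lemma continuous_radial_at (R : realType) (N : nat) (f : R -> R)
    (x : 'rV[R]_N) : {for enorm x, continuous f} ->
  {for x, continuous (fun y => f (enorm y))}.
Proof. by move=> cf; apply: continuous_comp => //; exact: continuous_enorm. Qed.

(** * Regularity of radial functions across the origin *)

Section radial_C2.
Context {R : realType} {N : nat}.
Variables (U w w1 : R -> R).
Hypothesis dU : forall r : R, 0 < r -> is_derive r 1 U (w r).
Hypothesis dw : forall r : R, 0 < r -> is_derive r 1 w (w1 r).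
Hypothesis cw1 : forall r : R, 0 < r -> {for r, continuous w1}.
Hypothesis U0 : (U r - U 0) / r @[r --> 0^'+] --> 0.
Hypothesis w0 : w r / r @[r --> 0^'+] --> 0.
Hypothesis w10 : w1 r @[r --> 0^'+] --> 0.
Implicit Types x y : 'rV[R]_N.

Let u x := U (enorm x).
Let g r := w r / r.
(* Since [x / 0 = 0], [g 0 = 0] and [hess i j 0 = 0], which are the correct
   values of the derivatives at the origin. *)
Let hess i j x := (i == j)%:R * g (enorm x) +
  (x 0 i / enorm x) * (x 0 j / enorm x) * (w1 (enorm x) - g (enorm x)).

Lemma is_derive_radial_fun0 i : is_derive (0 : 'rV[R]_N) (delta_mx 0 i) u 0.
Proof.
apply: is_derive_line.
apply: (@is_derive0_bound _ _ (fun r => `|(U r - U 0) / r|)).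
  by apply/norm_cvg0P; exact: U0.
move=> h h0; rewrite /u !addr0 scale0r enorm0 enormZ enorm_delta mulr1.
by rewrite normrM normfV normr_id mulrCA divff ?mulr1// normr_eq0.
Qed.

Lemma partial_radial i : partial i u = fun x => x 0 i * g (enorm x).
Proof.
apply/funext => x; rewrite /partial.
have [/eqP|x0] := eqVneq (enorm x) 0.
  rewrite enorm_eq0 => /eqP ->; rewrite mxE mul0r.
  by have /@derive_val := is_derive_radial_fun0 i.
by have /@derive_val := is_derive_radial_fun dU i x0.
Qed.

Lemma is_derive_partial_radial0 i j :
  is_derive (0 : 'rV[R]_N) (delta_mx 0 j) (partial i u) 0.
Proof.
rewrite partial_radial; apply: is_derive_line.
apply: (@is_derive0_bound _ _ (fun r => `|g r|)).
  by apply/norm_cvg0P; exact: w0.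
move=> h h0; have z : (0 : 'rV[R]_N) 0 i = 0 by rewrite mxE.
rewrite !addr0 scale0r z mul0r subr0 !mxE enormZ enorm_delta mulr1.
rewrite normrM ler_wpM2r// eqxx/=.
by rewrite normrM ler_piMr//; case: (i == j); rewrite ?normr1 ?normr0 ?ler01.
Qed.

Lemma partial2_radial i j : partial j (partial i u) = hess i j.
Proof.
apply/funext => x; rewrite /partial.
have [/eqP|x0] := eqVneq (enorm x) 0.
  rewrite enorm_eq0 => /eqP ->.
  have /@derive_val -> := is_derive_partial_radial0 i j.
  by rewrite /hess /g enorm0 invr0 !mulr0 mul0r addr0.
by have /@derive_val := is_derive_partial_radial dU dw i j x0.
Qed.

Lemma continuous_radial_slope (r : R) : 0 < r -> {for r, continuous g}.
Proof.
move=> r0; apply: cvgM; first exact/derive_continuous_at/dw.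
by apply: cvgV; [rewrite gt_eqF|exact: cvg_id].
Qed.

Lemma continuous_radial_fun : continuous u.
Proof.
move=> x; have [/eqP|x0] := eqVneq (enorm x) 0; last first.
  apply: continuous_radial_at => //.
  exact/derive_continuous_at/dU/enorm_gt0.
rewrite enorm_eq0 => /eqP ->; apply/continuous_withinNx.
apply/subr_cvg0.
(* The increment of [u] is factored as the norm times a difference quotient that tends to 0. *)
have : enorm x * ((U (enorm x) - U 0) / enorm x) @[x --> (0 : 'rV[R]_N)^'] -->
   (0 * 0 : R).
  apply: cvgM; last exact: (@cvg_radial0 _ _ (fun r => (U r - U 0) / r)).
  by have /continuous_withinNx := @continuous_enorm R N 0; rewrite enorm0.
rewrite mulr0; apply: cvg_trans; apply: near_eq_cvg; near=> y.
have y0 : enorm y != 0 by rewrite enorm_eq0; near: y; exact: nbhs_dnbhs_neq.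
by rewrite /u enorm0 mulrC divfK.
Unshelve. all: by end_near. Qed.

Lemma continuous_partial_radial i : continuous (partial i u).
Proof.
rewrite partial_radial => x; have [/eqP|x0] := eqVneq (enorm x) 0; last first.
  have ci : {for x, continuous (fun y : 'rV[R]_N => y 0 i)}.
    exact: coord_continuous.
  apply: (continuousM ci); apply: continuous_radial_at.
  exact/continuous_radial_slope/enorm_gt0.
rewrite enorm_eq0 => /eqP ->; apply/continuous_withinNx.
apply: cvgM.
  have ci : {for 0, continuous (fun y : 'rV[R]_N => y 0 i)}.
    exact: coord_continuous.
  exact/continuous_withinNx.
rewrite {2}/g enorm0 invr0 mulr0; exact: cvg_radial0 w0.
Qed.

Lemma continuous_hess_radial i j x : {for x, continuous (hess i j)}.
Proof.
have [/eqP|x0] := eqVneq (enorm x) 0; last first.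
  have cg : {for x, continuous (fun y => g (enorm y))}.
    exact/continuous_radial_at/continuous_radial_slope/enorm_gt0.
  have c1 : {for x, continuous (fun y => w1 (enorm y))}.
    exact/continuous_radial_at/cw1/enorm_gt0.
  have cV : {for x, continuous (fun y : 'rV[R]_N => (enorm y)^-1)}.
    by apply: continuousV => //; exact: continuous_enorm.
  have cc k : {for x, continuous (fun y : 'rV[R]_N => y 0 k)}.
    exact: coord_continuous.
  have ck : {for x, continuous (fun _ : 'rV[R]_N => (i == j)%:R : R)}.
    exact: cst_continuous.
  have cf k : {for x, continuous (fun y => y 0 k / enorm y)}.
    exact: (continuousM (cc k) cV).
  exact: (continuousD (continuousM ck cg)
    (continuousM (continuousM (cf i) (cf j)) (continuousB c1 cg))).
rewrite enorm_eq0 => /eqP ->; apply/continuous_withinNx.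
have -> : hess i j 0 = 0 by rewrite /hess /g enorm0 invr0 !mulr0 mul0r addr0.
(* The coordinates of [x / enorm x] have no limit at 0 but are bounded by 1, so a radial bound
   suffices. *)
apply: (@cvg0_le_norm _ _ _ _ _
  (fun x => `|g (enorm x)| + `|w1 (enorm x) - g (enorm x)|)).
  apply: (@cvg_radial0 _ _ (fun r => `|g r| + `|w1 r - g r|)).
  have w1g : w1 r - g r @[r --> 0^'+] --> (0 - 0 : R) by exact: cvgB.
  rewrite subr0 in w1g.
  have : `|g r| + `|w1 r - g r| @[r --> 0^'+] --> (0 + 0 : R).
    by apply: cvgD; apply/norm_cvg0P.
  by rewrite addr0.
near=> y.
have y0 : enorm y != 0 by rewrite enorm_eq0; near: y; exact: nbhs_dnbhs_neq.
have le1 k : `|y 0 k / enorm y| <= 1.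
  rewrite normrM normfV (ger0_norm (enorm_ge0 y)) ler_pdivrMr ?enorm_gt0//.
  by rewrite mul1r enorm_coord_le.
rewrite (le_trans (ler_normD _ _))// lerD//.
  by rewrite normrM ler_piMl//; case: (i == j); rewrite ?normr1 ?normr0 ?ler01.
by rewrite normrM ler_piMl// normrM mulr_ile1.
Unshelve. all: by end_near. Qed.

(** Off the origin the chain rule applies. At the origin the limits assumed for [(U r - U 0) / r],
    [w r / r] and [w1 r] make all first and second derivatives vanish, and do so continuously. *)
Lemma C2_radial : C2 u.
Proof.
split=> [|i]; split.
- exact: continuous_radial_fun.
- move=> i x; have [/eqP|x0] := eqVneq (enorm x) 0.
    by rewrite enorm_eq0 => /eqP ->; have [] := is_derive_radial_fun0 i.
  by have [] := is_derive_radial_fun dU i x0.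
- exact: continuous_partial_radial.
- exact: continuous_partial_radial.
- move=> j x; have [/eqP|x0] := eqVneq (enorm x) 0.
    by rewrite enorm_eq0 => /eqP ->; have [] := is_derive_partial_radial0 i j.
  by have [] := is_derive_partial_radial dU dw i j x0.
- by move=> j; rewrite partial2_radial => x; exact: continuous_hess_radial.
Qed.

Lemma laplacian_radial0 : laplacian u 0 = 0.
Proof.
rewrite /laplacian big1// => i _.
by have /@derive_val := is_derive_partial_radial0 i i.
Qed.

End radial_C2.

(** * Blow-up in the superlinear case *)

(* Steps of length [3 H lam^n] starting from [A] stay in [[A, 2 A]]; [lam] and
   [H] are chosen so that [c (H lam^n)^k (2^n V 0)^d = 1], hence each step
   doubles [V]. *)
Lemma no_superlinear_doubling (R : realType) (V : R -> R) (c k d : R) :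
  0 < c -> 0 < k -> 0 < d -> 0 < V 0 ->
  (forall x y : R, 0 <= x -> x <= y -> V x <= V y) ->
  (forall A r h : R, 1 <= A -> A <= r -> 0 < h -> r + 3 * h <= 2 * A ->
    V r + c * h `^ k * V r `^ (1 + d) <= V (r + 3 * h)) ->
  False.
Proof.
move=> c0 k0 d0 v0 ndV step.
pose lam : R := 2 `^ (- (d / k)).
have lam0 : 0 < lam by rewrite powR_gt0.
have lam1 : lam < 1.
  rewrite /lam /powR pnatr_eq0/= expR_lt1.
  by rewrite mulNr oppr_lt0 mulr_gt0 ?divr_gt0// ln_gt0// ltr1n.
pose H := (c * V 0 `^ d) `^ (- k^-1).
have H0 : 0 < H by rewrite powR_gt0// mulr_gt0// powR_gt0.
have Hk : c * H `^ k * V 0 `^ d = 1.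
  rewrite -powRrM mulNr mulVf ?gt_eqF// powR_inv1; last first.
    by rewrite mulr_ge0 ?powR_ge0// ltW.
  by rewrite mulrAC divff// mulf_neq0 ?gt_eqF// powR_gt0.
have lamk n : (lam ^+ n) `^ k * (2 ^+ n) `^ d = 1.
  rewrite -!powR_mulrn ?ler0n ?(ltW lam0)// -!powRrM -powRD; last first.
    by rewrite pnatr_eq0 implybT.
  by rewrite (_ : _ + _ = 0) ?powRr0//; field; rewrite gt_eqF.
(* The steps add up to less than [3 H / (1 - lam)], which this choice makes at most [A]. *)
pose A := Num.max 1 (3 * H / (1 - lam)).
have A1 : 1 <= A by rewrite le_max lexx.
have AH : 3 * H <= A * (1 - lam).
  by rewrite -ler_pdivrMr ?subr_gt0// le_max lexx orbT.
(* Closed form of [A] plus the first [n] steps [3 H lam^i]. *)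
pose r n := A + 3 * H * (1 - lam ^+ n) / (1 - lam).
have rS n : r n.+1 = r n + 3 * (H * lam ^+ n).
  by rewrite /r exprS; field; rewrite subr_eq0 gt_eqF.
have lamn0 n : 0 < lam ^+ n by rewrite exprn_gt0.
have lamn1 n : lam ^+ n <= 1 by rewrite exprn_ile1 ?ltW.
have rA n : A <= r n.
  by rewrite lerDl divr_ge0 ?mulr_ge0 ?subr_ge0 ?(ltW H0) ?(ltW lam1).
have r2A n : r n <= 2 * A.
  rewrite /r (_ : 2 * A = A + A); last by ring.
  rewrite lerD2l ler_pdivrMr ?subr_gt0// (le_trans _ AH)//.
  by rewrite ler_piMr ?gerBl ?mulr_ge0 ?(ltW H0) ?(ltW (lamn0 n)).
have A0 : 0 <= A by rewrite (le_trans ler01).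
have dbl n : 2 ^+ n * V 0 <= V (r n).
  elim: n => [|n IH].
    by rewrite expr0 mul1r ndV// (le_trans A0).
  have Vn0 : 0 < V (r n) by rewrite (lt_le_trans v0)// ndV// (le_trans A0).
  rewrite rS.
  have hn0 : 0 < H * lam ^+ n by rewrite mulr_gt0.
  have := step A (r n) (H * lam ^+ n) A1 (rA n) hn0.
  rewrite -rS => /(_ (r2A _)); apply: le_trans.
  (* With [2 ^+ n * V 0] in place of [V (r n)] the product is exactly 1, and the induction
     hypothesis can only increase it. The increment of [V] is then at least [V (r n)]. *)
  have big : 1 <= c * (H * lam ^+ n) `^ k * V (r n) `^ d.
    have -> : 1 = c * (H * lam ^+ n) `^ k * (2 ^+ n * V 0) `^ d.
      rewrite !powRM ?exprn_ge0 ?(ltW lam0) ?(ltW H0) ?(ltW v0)//.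
      rewrite (_ : _ * _ = (c * H `^ k * V 0 `^ d) *
        ((lam ^+ n) `^ k * (2 ^+ n) `^ d)); last by ring.
      by rewrite Hk lamk mulr1.
    rewrite ler_wpM2l ?mulr_ge0 ?powR_ge0 ?(ltW c0)//.
    rewrite ge0_ler_powR ?nnegrE ?(ltW d0) ?(ltW Vn0)//.
    by rewrite mulr_ge0 ?(ltW v0)// exprn_ge0.
  have -> : V (r n) `^ (1 + d) = V (r n) * V (r n) `^ d.
    rewrite powRD; last by rewrite (gt_eqF Vn0) implybT.
    by rewrite powRr1 ?(ltW Vn0).
  have : 0 <= (c * (H * lam ^+ n) `^ k * V (r n) `^ d - 1) * V (r n).
    by rewrite mulr_ge0 ?subr_ge0 ?(ltW Vn0).
  by rewrite exprS; lra.
(* All points [r n] lie below [2 * A], so the single value [V (2 * A)] bounds every multiple of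
   [V 0], against the Archimedean property. *)
have unb n : n%:R * V 0 <= V (2 * A).
  have : V (r n) <= V (2 * A) by rewrite ndV// (le_trans A0).
  apply: le_trans; apply: le_trans (dbl n).
  by rewrite ler_pM2r// -natrX ler_nat ltnW// ltn_expl.
have V2A : 0 <= V (2 * A) by have := unb 0; rewrite mul0r.
have := unb (Num.bound (V (2 * A) / V 0)).
rewrite -ler_pdivlMr// leNgt => /negP; apply.
by apply: archi_boundP; rewrite divr_ge0// ltW.
Qed.

(** * Estimates for the equation w' + n w / t = F *)

Section weighted_mean_value.
Context {R : realType} (n : nat) (w w1 F : R -> R).
Hypothesis n0 : (0 < n)%N.
Hypothesis dw : forall t : R, is_derive t 1 w (w1 t).
Hypothesis eqF : forall t : R, 0 < t -> w1 t + n%:R * (w t / t) = F t.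

(* [eqF] says that [t^n w] has derivative [t^n F] on the positive half-line. *)
Lemma weighted_MVT (x y : R) : 0 <= x -> x < y ->
  exists2 c, x < c < y & y ^+ n * w y - x ^+ n * w x = c ^+ n * F c * (y - x).
Proof.
move=> x0 xy.
have dW (t : R) : is_derive t 1 (fun t => t ^+ n * w t)
    (t ^+ n * w1 t + n%:R * t ^+ n.-1 * w t).
  have dX : is_derive t 1 (fun t : R => t ^+ n) (n%:R * t ^+ n.-1).
    apply: DeriveDef; first exact: exprn_derivable.
    by rewrite exp_derive /GRing.scale/= mulr1.
  by apply: is_derive_eq; rewrite /GRing.scale/=; ring.
have cW : continuous (fun t : R => t ^+ n * w t).
  move=> t; apply/differentiable_continuous/derivable1_diffP.
  by have [] := dW t.
have [c /[!in_itv]/= xcy ->] := MVT xy (fun (t : R) _ => dW t)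
  (continuous_subspaceT cW).
exists c => //; congr (_ * _).
have c0 : 0 < c by case/andP: xcy => /(le_lt_trans x0).
have cn : c ^+ n = c * c ^+ n.-1 by rewrite -exprS prednK.
rewrite -eqF// cn.
by field; rewrite gt_eqF.
Qed.

(** Since [n > 0], the term [x ^+ n * w x] vanishes at [x = 0], so [t ^+ n * w t] takes its sign
    from [F]. *)
Lemma weighted_ge0 : (forall t : R, 0 < t -> 0 <= F t) ->
  forall t : R, 0 < t -> 0 <= w t.
Proof.
move=> F0 t t0; have [c /andP[c0 ct]] := weighted_MVT (lexx 0) t0.
rewrite expr0n gtn_eqF// mul0r !subr0 => e.
rewrite -(pmulr_rge0 _ (exprn_gt0 n t0)) e.
by rewrite !mulr_ge0 ?exprn_ge0 ?F0 ?ltW.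
Qed.

(** Dropping the nonnegative term at [r] leaves [t ^+ n * w t >= r ^+ n * m * (t - r)]; [t <= 2 * r]
    then bounds [(r / t)^n] below by [2 ^- n], uniformly in [r]. *)
Lemma weighted_lower (m h r t : R) : 0 < r -> 0 <= m -> 0 <= h ->
  0 <= w r -> (forall c, r < c < t -> m <= F c) ->
  r + h <= t -> r < t -> t <= 2 * r -> 2 ^- n * h * m <= w t.
Proof.
move=> r0 m0 h0 wr Fm rht rt t2r.
have [c /andP[rc ct] e] := weighted_MVT (ltW r0) rt.
have t0 : 0 < t by exact: lt_trans rt.
rewrite -(ler_pM2l (exprn_gt0 n t0)).
rewrite -(subrK (r ^+ n * w r) (t ^+ n * w t)) e.
apply: ler_wpDr; first by rewrite mulr_ge0 ?exprn_ge0 ?(ltW r0).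
apply: (@le_trans _ _ (r ^+ n * m * h)).
  rewrite (_ : t ^+ n * _ = (t ^+ n * 2 ^- n) * (m * h)); last by ring.
  rewrite -[leRHS]mulrA ler_wpM2r ?mulr_ge0// -expr_div_n.
  rewrite lerXn2r ?nnegrE ?divr_ge0 ?(ltW r0) ?(ltW t0)//.
  by rewrite ler_pdivrMr// mulrC.
apply: ler_pM => //.
- by rewrite mulr_ge0 ?exprn_ge0 ?(ltW r0).
- apply: ler_pM => //; first by rewrite exprn_ge0// ltW.
    by rewrite lerXn2r ?nnegrE ?(ltW rc) ?(ltW r0) ?(ltW (lt_trans r0 rc)).
  by rewrite Fm// rc ct.
- by rewrite lerBrDl.
Qed.

End weighted_mean_value.

Lemma ge1_powR (R : realType) (x a : R) : 1 <= x -> 0 <= a -> 1 <= x `^ a.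
Proof. by move=> x1 a0; rewrite -(powRr0 x) ler_powR. Qed.

(** On three successive intervals of length [h], first [w] becomes large, then [z], then [V] grows.
    From [1 <= A <= r] and [r + 3 h <= 2 A], the weights [t^a] and [t^b] are at least 1 and all
    points are within a factor 2 of each other, so the constants do not depend on [A]. *)
Lemma radial_system_blowup (R : realType) (n : nat) (a b p q s : R)
    (V w w1 z z1 : R -> R) :
  (0 < n)%N -> 0 < a -> 0 < b -> 0 < p -> 0 < q -> 0 < s ->
  0 < p * s + q - 1 ->
  (forall t : R, 0 < V t) ->
  (forall t : R, is_derive t 1 V (z t)) ->
  (forall t : R, is_derive t 1 w (w1 t)) ->
  (forall t : R, is_derive t 1 z (z1 t)) ->
  (forall t : R, 0 < t -> w1 t + n%:R * (w t / t) = t `^ a * V t `^ p) ->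
  (forall t : R, 0 < t ->
     z1 t + n%:R * (z t / t) = t `^ b * V t `^ q * `|w t| `^ s) ->
  False.
Proof.
move=> n0 a0 b0 p0 q0 s0 pqs Vgt0 dV dw dz eqw eqz.
have wge0 : forall t : R, 0 < t -> 0 <= w t.
  apply: (weighted_ge0 n0 dw eqw) => t t0.
  by rewrite mulr_ge0 ?powR_ge0.
have zge0 : forall t : R, 0 < t -> 0 <= z t.
  apply: (weighted_ge0 n0 dz eqz) => t t0.
  by rewrite !mulr_ge0 ?powR_ge0.
have cV : continuous V.
  move=> t; apply/differentiable_continuous/derivable1_diffP.
  by have [] := dV t.
have MV (x y : R) : x < y -> exists2 c, x < c < y & V y - V x = z c * (y - x).
  move=> xy.
  have [c /[!in_itv]/= xcy ->] := MVT xy (fun (t : R) _ => dV t)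
    (continuous_subspaceT cV).
  by exists c.
have ndV (x y : R) : 0 <= x -> x <= y -> V x <= V y.
  move=> x0; rewrite le_eqVlt => /predU1P[->//|xy].
  have [c /andP[xc cy] e] := MV _ _ xy.
  rewrite -subr_ge0 e mulr_ge0 ?subr_ge0 ?(ltW xy)// zge0//.
  exact: le_lt_trans xc.
(* The first [2 ^- n] comes from the bound on [z], the second, raised to the power [s], from the
   bound on [w]. The exponent of [h] is [s] from [w] plus 1 each from [z] and [V]. *)
apply: (@no_superlinear_doubling _ V (2 ^- n * (2 ^- n) `^ s) (2 + s)
  (p * s + q - 1)) => //.
  by rewrite addr_gt0.
move=> A r h A1 Ar h0 rhA.
have r1 : 1 <= r by exact: le_trans Ar.
have r0 : 0 < r by exact: lt_le_trans r1.
have rh0 : 0 < r + h by rewrite addr_gt0.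
have r2h0 : 0 < r + 2 * h by rewrite addr_gt0// mulr_gt0.
pose m := V r `^ p; pose k := 2 ^- n * h * m.
have m0 : 0 <= m by exact: powR_ge0.
have k0 : 0 <= k by rewrite !mulr_ge0 ?(ltW h0)// invr_ge0 exprn_ge0.
have c1 (t e : R) : 1 <= t -> 0 < e -> 1 <= t `^ e.
  by move=> ? /ltW; exact: ge1_powR.
have Vr (t e : R) : r <= t -> 0 < e -> V r `^ e <= V t `^ e.
  move=> rt e0; rewrite ge0_ler_powR ?nnegrE ?(ltW e0) ?(ltW (Vgt0 _))//.
  by apply: ndV => //; exact: ltW.
have wlo (t : R) : r + h <= t -> t <= 2 * A -> k <= w t.
  move=> rht tA; apply: (@weighted_lower _ n w w1 _ n0 dw eqw m h r t) => //.
  - exact: ltW.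
  - exact: wge0.
  - move=> c /andP[rc ct]; rewrite -[leLHS]mul1r ler_pM// ?Vr ?(ltW rc)//.
    by rewrite c1// (le_trans r1)// ltW.
  - by rewrite (lt_le_trans _ rht)// ltrDl.
  - by rewrite (le_trans tA)// ler_pM2l.
have zlo (t : R) : r + 2 * h <= t -> t <= 2 * A ->
    2 ^- n * h * (V r `^ q * k `^ s) <= z t.
  move=> rht tA.
  apply: (@weighted_lower _ n z z1 _ n0 dz eqz _ h (r + h) t) => //.
  - by rewrite mulr_ge0 ?powR_ge0.
  - exact: ltW.
  - exact: zge0.
  - move=> c /andP[rc ct].
    have rlec : r <= c by rewrite (le_trans _ (ltW rc))// lerDl ltW.
    have kw : k <= w c by rewrite wlo// ltW// (lt_le_trans ct).
    rewrite ler_pM ?powR_ge0//.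
      by rewrite -[leLHS]mul1r ler_pM ?powR_ge0 ?Vr ?c1// (le_trans r1).
    rewrite ger0_norm ?(le_trans k0)// ge0_ler_powR ?nnegrE ?(ltW s0)//.
    exact: le_trans kw.
  - by rewrite (le_trans _ rht)//; lra.
  - by rewrite (lt_le_trans _ rht)//; lra.
  - by lra.
have r23 : r + 2 * h < r + 3 * h by lra.
have [c /andP[rc cr] e] := MV _ _ r23.
have zc : 2 ^- n * h * (V r `^ q * k `^ s) <= z c.
  by apply: zlo; [exact: ltW|rewrite ltW// (lt_le_trans cr)].
have V2 : V r <= V (r + 2 * h) by apply: ndV; lra.
have -> : V (r + 3 * h) = V (r + 2 * h) + z c * h by lra.
apply: lerD => //.
apply: (@le_trans _ _ (2 ^- n * h * (V r `^ q * k `^ s) * h)); last first.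
  by rewrite ler_pM2r.
rewrite /k /m !powRM ?(ltW h0) ?mulr_ge0 ?powR_ge0 ?invr_ge0 ?exprn_ge0//;
  rewrite ?(ltW h0)//.
rewrite -powRrM powRD; last by rewrite (gt_eqF h0) implybT.
rewrite powR_mulrn ?(ltW h0)//.
rewrite (_ : 1 + _ = q + p * s); last by ring.
rewrite powRD; last by rewrite (gt_eqF (Vgt0 r)) implybT.
rewrite le_eqVlt; apply/orP; left; apply/eqP; ring.
Qed.

(** * From a radial solution to the ordinary differential system *)

Lemma is_derive_ray (R : realType) (V : normedModType R) (f : V -> R)
    (e : V) (t df : R) :
  is_derive (t *: e) e f df -> is_derive t 1 (fun r => f (r *: e)) df.
Proof.
move=> [dfx dfE].
have E : (fun h : R => h^-1 *: ((f \o shift (t *: e)) (h *: e) - f (t *: e))) =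
    (fun h : R => h^-1 *: (((fun r => f (r *: e)) \o shift t) (h *: 1) -
      f (t *: e))).
  by apply/funext => h /=; rewrite [_%:A]mulr1 scalerDl.
apply: DeriveDef.
  by move: dfx; rewrite /derivable E.
by rewrite -dfE /derive E.
Qed.

(** Restriction to the line spanned by a basis vector [e]: a radial [f] satisfies
    [f x = f (enorm x *: e)], so the radial formulas apply to its profile along [e]. The profile is
    twice differentiable on the whole line, including at 0, where the mean value arguments start. *)
Lemma radial_solution_exponents (R : realType) (N : nat) (a b p q s : R)
    (u v : 'rV[R]_N -> R) :
  (2 <= N)%N -> 0 < a -> 0 < b -> 0 < p -> 0 < q -> 0 < s ->
  positive_radial_solution a b p q s u v -> p * s + q - 1 <= 0.
Proof.
move=> N2 a0 b0 p0 q0 s0 [[C2u C2v] [_ v0] [ru rv] sys].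
rewrite leNgt; apply/negP => pqs.
have N0 : (0 < N)%N by exact: leq_trans N2.
pose i0 : 'I_N := Ordinal N0; pose e : 'rV[R]_N := delta_mx 0 i0.
have ray (f : 'rV[R]_N -> R) : has_partials f ->
    forall t : R, is_derive t 1 (fun r => f (r *: e)) (partial i0 f (t *: e)).
  by move=> df t; apply: is_derive_ray; apply: derivableP; exact: df.
have en (t : R) : 0 < t -> enorm (t *: e) = t.
  by move=> t0; rewrite enormZ enorm_delta mulr1 gtr0_norm.
have radE (f : 'rV[R]_N -> R) : radial f -> f = fun x => f (enorm x *: e).
  move=> rf; apply/funext => x; apply: rf.
  by rewrite enormZ enorm_delta mulr1 ger0_norm ?enorm_ge0.
have ray1 (f : 'rV[R]_N -> R) : C2 f -> forall t : R,
    is_derive t 1 (fun r => f (r *: e)) (partial i0 f (t *: e)).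
  by move=> [[_ df _] _]; exact: ray.
have ray2 (f : 'rV[R]_N -> R) : C2 f -> forall t : R,
    is_derive t 1 (fun r => partial i0 f (r *: e))
      (partial i0 (partial i0 f) (t *: e)).
  by move=> [_ d2f]; apply: ray; have [] := d2f i0.
have n1 : N.-1%:R = N%:R - 1 :> R by rewrite -subn1 natrB.
have lap (f : 'rV[R]_N -> R) (t : R) : radial f -> C2 f -> 0 < t ->
    laplacian f (t *: e) = partial i0 (partial i0 f) (t *: e) +
      N.-1%:R * (partial i0 f (t *: e) / t).
  move=> rf C2f t0; have te0 : enorm (t *: e) != 0 by rewrite en// gt_eqF.
  rewrite {1}(radE f rf).
  rewrite (laplacian_radial (fun r _ => ray1 f C2f r)
    (fun r _ => ray2 f C2f r) te0).
  by rewrite en// n1.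
have gradu (t : R) : 0 < t ->
    enorm (grad u (t *: e)) = `|partial i0 u (t *: e)|.
  move=> t0; have te0 : enorm (t *: e) != 0 by rewrite en// gt_eqF.
  rewrite {1}(radE u ru).
  by rewrite (enorm_grad_radial (fun r _ => ray1 u C2u r) te0) en.
have n0 : (0 < N.-1)%N by rewrite -subn1 subn_gt0.
apply: (radial_system_blowup n0 a0 b0 p0 q0 s0 pqs (fun t => v0 (t *: e))
  (ray1 v C2v) (ray2 u C2u) (ray2 v C2v)).
- by move=> t t0; rewrite -lap//; have [-> _] := sys (t *: e); rewrite en.
- move=> t t0; rewrite -lap//.
  by have [_ ->] := sys (t *: e); rewrite en// gradu.
Qed.

(** * The radial Poisson equation *)

(** A class of integrands on the nonnegative half-line stable under products, powers and radial
    means. Continuity is not part of it, because the fixed point is at first only known to be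
    monotone. *)
Definition loc_bounded_ge0 (R : realType) (f : R -> R) :=
  measurable_fun [set: R] f /\
  forall r : R, exists B, forall t, 0 <= t -> t <= r -> 0 <= f t <= B.

Definition primitive (R : realType) (f : R -> R) (r : R) : R :=
  \int[@lebesgue_measure R]_(t in `[0, r]) f t.

(* The factor is the real power [r `^ (- n)] rather than [r ^- n] because the
   library provides the measurability of the former; both vanish at [0] for
   [n > 0]. *)
Definition radial_mean (R : realType) (n : nat) (f : R -> R) (r : R) : R :=
  r `^ (- n%:R) * primitive (fun t => t ^+ n * f t) r.

Section primitive_theory.
Context {R : realType}.
Implicit Types (f g : R -> R) (r t : R).
Notation mu := (@lebesgue_measure R).

Lemma loc_bounded_ge0_itv f r t : loc_bounded_ge0 f -> 0 <= t -> 0 <= f t.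
Proof. by move=> [_ bf] t0; have [B /(_ t t0 (lexx _))/andP[]] := bf t. Qed.

Lemma loc_bounded_integrable f r : loc_bounded_ge0 f ->
  mu.-integrable `[0, r] (EFin \o f).
Proof.
move=> [mf bf]; apply: measurable_bounded_integrable => //.
- exact/compact_finite_measure/segment_compact.
- exact: measurable_funTS.
have [B HB] := bf r.
exists B; split; first exact: num_real.
move=> x Bx t/=; rewrite in_itv/= => /andP[t0 tr].
have /andP[f0 fB] := HB _ t0 tr.
by rewrite ger0_norm// (le_trans fB)// ltW.
Qed.

Lemma primitive_le0 f r : r <= 0 -> primitive f r = 0.
Proof.
rewrite /primitive le_eqVlt => /predU1P[->|r0].
  by rewrite set_itv1 Rintegral_set1.
by rewrite set_itv_ge ?Rintegral_set0// -leNgt bnd_simp.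
Qed.

Lemma le_primitive f g r : loc_bounded_ge0 f -> loc_bounded_ge0 g ->
  (forall t, 0 <= t -> t <= r -> f t <= g t) -> primitive f r <= primitive g r.
Proof.
move=> bf bg fg; apply: le_Rintegral => //.
- exact: loc_bounded_integrable.
- exact: loc_bounded_integrable.
- by move=> t/=; rewrite in_itv/= => /andP[t0 tr]; exact: fg.
Qed.

Lemma primitive_ge0 f r : loc_bounded_ge0 f -> 0 <= primitive f r.
Proof.
move=> bf; apply: Rintegral_ge0 => t/=; rewrite in_itv/= => /andP[t0 _].
exact: loc_bounded_ge0_itv bf t0.
Qed.

Lemma primitive_ndecr f r t : loc_bounded_ge0 f -> r <= t ->
  primitive f r <= primitive f t.
Proof.
move=> bf rt; have [r0|r0] := leP r 0.
  by rewrite (primitive_le0 _ r0) primitive_ge0.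
rewrite /primitive -subr_ge0 Rintegral_itvB ?bnd_simp ?(ltW r0)//; last first.
  exact: loc_bounded_integrable.
apply: Rintegral_ge0 => x/=; rewrite in_itv/= => /andP[rx _].
exact: loc_bounded_ge0_itv bf (ltW (lt_trans r0 rx)).
Qed.

Lemma primitive_le_cst f r B : loc_bounded_ge0 f -> 0 <= r ->
  (forall t, 0 <= t -> t <= r -> f t <= B) -> primitive f r <= B * r.
Proof.
move=> bf r0 fB.
have -> : B * r = \int[mu]_(t in `[0, r]) B.
  rewrite Rintegral_cst//= lebesgue_measure_itv/= lte_fin.
  case: ltP => [_|r_le0]; first by rewrite -EFinD subr0.
  by rewrite (@le_anti _ _ r 0) ?r_le0 ?mulr0.
apply: le_Rintegral => //.
- exact: loc_bounded_integrable.
- apply: measurable_bounded_integrable => //.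
    exact/compact_finite_measure/segment_compact.
  exists `|B|; split; first exact: num_real.
  by move=> x Bx t _; exact: ltW.
- by move=> t/=; rewrite in_itv/= => /andP[t0 tr]; exact: fB.
Qed.

Lemma measurable_primitive f : loc_bounded_ge0 f ->
  measurable_fun [set: R] (primitive f).
Proof.
by move=> bf; apply: nondecreasing_measurable => // x y; exact: primitive_ndecr.
Qed.

Lemma continuous_primitive f r : loc_bounded_ge0 f -> 0 < r ->
  {for r, continuous (primitive f)}.
Proof.
move=> bf r0.
(* Integrating up to [r + 1] makes [r] an interior point. *)
have r1 : 0 < r + 1 by rewrite addr_gt0.
have := parameterized_integral_continuous (ltW r1)
  (loc_bounded_integrable (r + 1) bf).
move=> /(continuous_within_itvP _ r1)[+ _ _]; apply.
by rewrite in_itv/= r0 ltrDl ltr01.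
Qed.

Lemma is_derive_primitive f r : loc_bounded_ge0 f -> 0 < r ->
  {for r, continuous f} -> is_derive r 1 (primitive f) (f r).
Proof.
move=> bf r0 cf.
have rr : r < r + 1 by rewrite ltrDl.
have [df dE] := continuous_FTC1_closed rr
  (loc_bounded_integrable (r + 1) bf) r0 cf.
by apply: DeriveDef; [exact: df|rewrite -derive1E].
Qed.

Lemma loc_boundedM f g : loc_bounded_ge0 f -> loc_bounded_ge0 g ->
  loc_bounded_ge0 (fun t => f t * g t).
Proof.
move=> [mf bf] [mg bg]; split; first exact: measurable_funM.
move=> r; have [B HB] := bf r; have [C HC] := bg r.
exists (B * C) => t t0 tr.
have /andP[f0 fB] := HB _ t0 tr; have /andP[g0 gC] := HC _ t0 tr.
by rewrite mulr_ge0//= ler_pM.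
Qed.

Lemma loc_bounded_powR f (e : R) : 0 <= e -> loc_bounded_ge0 f ->
  loc_bounded_ge0 (fun t => f t `^ e).
Proof.
move=> e0 [mf bf]; split.
  exact: (measurableT_comp (measurable_powR e) mf).
move=> r; have [B HB] := bf r; exists (B `^ e) => t t0 tr.
have /andP[f0 fB] := HB _ t0 tr.
by rewrite powR_ge0/= ge0_ler_powR// nnegrE// (le_trans f0).
Qed.

Lemma loc_bounded_id : loc_bounded_ge0 (@id R).
Proof. by split => // r; exists r => t -> ->. Qed.

Lemma loc_bounded_exprn n : loc_bounded_ge0 (fun t : R => t ^+ n).
Proof.
split; first exact: exprn_measurable.
move=> r; exists (r ^+ n) => t t0 tr.
by rewrite exprn_ge0//= lerXn2r// nnegrE// (le_trans t0).
Qed.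

Lemma radial_meanE n f r : 0 < r ->
  radial_mean n f r = primitive (fun t => t ^+ n * f t) r / r ^+ n.
Proof.
by move=> r0; rewrite /radial_mean powRN powR_mulrn ?(ltW r0)// mulrC.
Qed.

Lemma radial_mean_le0 n f r : r <= 0 -> radial_mean n f r = 0.
Proof. by move=> r0; rewrite /radial_mean primitive_le0// mulr0. Qed.

Lemma radial_mean_ge0 n f r : loc_bounded_ge0 f -> 0 <= radial_mean n f r.
Proof.
move=> bf; rewrite mulr_ge0 ?powR_ge0// primitive_ge0//.
by apply: loc_boundedM => //; exact: loc_bounded_exprn.
Qed.

(** Bounding [t ^+ n] by [r ^+ n] under the integral cancels the weight. *)
Lemma radial_mean_le_cst n f r B : loc_bounded_ge0 f -> 0 <= r ->
  (forall t, 0 <= t -> t <= r -> f t <= B) -> radial_mean n f r <= B * r.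
Proof.
move=> bf; rewrite le_eqVlt => /predU1P[<- _|r0 fB].
  by rewrite radial_mean_le0// mulr0.
have bfn : loc_bounded_ge0 (fun t => t ^+ n * f t).
  by apply: loc_boundedM => //; exact: loc_bounded_exprn.
rewrite radial_meanE// ler_pdivrMr ?exprn_gt0//.
rewrite mulrAC [B * _]mulrC; apply: primitive_le_cst => //; first exact: ltW.
move=> t t0 tr; rewrite ler_pM ?exprn_ge0 ?fB//.
  exact: loc_bounded_ge0_itv bf t0.
by rewrite lerXn2r// nnegrE// (le_trans t0).
Qed.

Lemma le_radial_mean n f g r : loc_bounded_ge0 f -> loc_bounded_ge0 g ->
  (forall t, 0 <= t -> t <= r -> f t <= g t) ->
  radial_mean n f r <= radial_mean n g r.
Proof.
move=> bf bg fg; rewrite ler_wpM2l ?powR_ge0//; apply: le_primitive.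
- by apply: loc_boundedM => //; exact: loc_bounded_exprn.
- by apply: loc_boundedM => //; exact: loc_bounded_exprn.
- by move=> t t0 tr; rewrite ler_wpM2l ?exprn_ge0 ?fg.
Qed.

Lemma loc_bounded_radial_mean n f : loc_bounded_ge0 f ->
  loc_bounded_ge0 (radial_mean n f).
Proof.
move=> bf; split.
  apply: measurable_funM; first exact: measurable_powR.
  apply: measurable_primitive.
  by apply: loc_boundedM => //; exact: loc_bounded_exprn.
move=> r; have [B HB] := bf.2 r; exists (B * r) => t t0 tr.
have B0 : 0 <= B by have /andP[/le_trans] := HB _ t0 tr; apply.
rewrite radial_mean_ge0//= (@le_trans _ _ (B * t)) ?ler_wpM2l//.
apply: radial_mean_le_cst => // x x0 xt.
by have /andP[] := HB _ x0 (le_trans xt tr).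
Qed.

(** This is [(r^n w)' = r^n f] expanded: for [n = N - 1] the radial mean is the slope of a radial
    function with Laplacian [f]. *)
Lemma is_derive_radial_mean n f r : (0 < n)%N -> loc_bounded_ge0 f -> 0 < r ->
  {for r, continuous f} ->
  is_derive r 1 (radial_mean n f) (f r - n%:R * (radial_mean n f r / r)).
Proof.
move=> n0 bf r0 cf.
have bfn : loc_bounded_ge0 (fun t => t ^+ n * f t).
  by apply: loc_boundedM => //; exact: loc_bounded_exprn.
have cfn : {for r, continuous (fun t => t ^+ n * f t)}.
  by apply: continuousM => //; exact: exprn_continuous.
have dP := is_derive_primitive bfn r0 cfn.
(* Near [r > 0] the real power in [radial_mean] agrees with the inverse of an integer power. *)
apply: (@near_eq_is_derive _ _ _
  (fun t => primitive (fun t => t ^+ n * f t) t * (t ^+ n)^-1)).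
  near=> t; rewrite radial_meanE//; near: t; exact: lt_nbhsr.
have dX : is_derive r 1 (fun t : R => t ^+ n) (n%:R * r ^+ n.-1).
  apply: DeriveDef; first exact: exprn_derivable.
  by rewrite exp_derive /GRing.scale/= mulr1.
have rn0 : r ^+ n != 0 by rewrite expf_neq0// gt_eqF.
have dV : is_derive r 1 (fun t : R => (t ^+ n)^-1)
    (- (r ^+ n) ^- 2 * (n%:R * r ^+ n.-1)).
  apply: DeriveDef; first exact: derivableV.
  by rewrite deriveV// derive_val.
apply: is_derive_eq; rewrite /GRing.scale/= radial_meanE//.
have rn : r ^+ n = r * r ^+ n.-1 by rewrite -exprS prednK.
rewrite rn; field.
by rewrite expf_neq0 ?gt_eqF.
Unshelve. all: by end_near. Qed.

End primitive_theory.

(** The solution of [(r^n U')' = r^n f] normalised by [U 0 = 1]; for nonnegative [f] the slope is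
    nonnegative, so [U] stays positive. *)
Definition radial_potential (R : realType) (n : nat) (f : R -> R) (r : R) : R :=
  1 + primitive (radial_mean n f) r.

(** * Classical solutions of the Poisson equation with a radial source *)

Section radial_poisson.
Context {R : realType} (N : nat) (f : R -> R).
Hypothesis N2 : (2 <= N)%N.
Hypothesis bf : loc_bounded_ge0 f.
Hypothesis cf : forall r : R, 0 < r -> {for r, continuous f}.
Hypothesis f0 : f 0 = 0.
Hypothesis limf : f r @[r --> 0^'+] --> 0.

Let w := radial_mean N.-1 f.
Let U := radial_potential N.-1 f.
Let w1 r := f r - N.-1%:R * (w r / r).

Let n0 : (0 < N.-1)%N.
Proof. by rewrite -subn1 subn_gt0. Qed.

Let bw : loc_bounded_ge0 w.
Proof. exact: loc_bounded_radial_mean. Qed.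

Let dw (r : R) : 0 < r -> is_derive r 1 w (w1 r).
Proof. by move=> r0; apply: is_derive_radial_mean => //; exact: cf. Qed.

Let dU (r : R) : 0 < r -> is_derive r 1 U (w r).
Proof.
move=> r0.
have dp := is_derive_primitive bw r0 (derive_continuous_at (dw r0)).
apply: is_derive_eq (is_deriveD (is_derive_cst (1 : R) r 1) dp) _.
by rewrite add0r.
Qed.

(** The quotient is at most any bound of [f] on [[0, r]], and such bounds tend to 0. *)
Let cvg_w : w r / r @[r --> 0^'+] --> 0.
Proof.
apply/cvgr0Pnorm_le => e e0.
move/cvgr0Pnorm_le : limf => /(_ e e0)[d /= d0 Hd].
near=> r.
have r0 : 0 < r by near: r; exact: nbhs_right_gt.
rewrite ger0_norm ?divr_ge0 ?(ltW r0)//; last exact: radial_mean_ge0.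
rewrite ler_pdivrMr//; apply: (radial_mean_le_cst _ bf (ltW r0)).
(* The right-hand limit says nothing at [t = 0]; there [f 0 = 0] is used. *)
move=> t; rewrite le_eqVlt => /predU1P[<- _|t0 tr]; first by rewrite f0 ltW.
apply: (le_trans (ler_norm _)); apply: Hd => //=.
by rewrite sub0r normrN gtr0_norm// (le_lt_trans tr).
Unshelve. all: by end_near. Qed.

Let cvg_w1 : w1 r @[r --> 0^'+] --> 0.
Proof.
have : f r - N.-1%:R * (w r / r) @[r --> 0^'+] --> (0 - N.-1%:R * 0 : R).
  by apply: cvgB => //; apply: cvgM => //; exact: cvg_cst.
by rewrite mulr0 subr0.
Qed.

Let continuous_w1 (r : R) : 0 < r -> {for r, continuous w1}.
Proof.
move=> r0; have cw := derive_continuous_at (dw r0).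
have ck : {for r, continuous (fun _ : R => N.-1%:R : R)}.
  exact: cst_continuous.
have cV : {for r, continuous (fun t : R => t^-1)}.
  by apply: continuousV => //; rewrite gt_eqF.
exact: (continuousB (cf r0) (continuousM ck (continuousM cw cV))).
Qed.

(** If [f <= B] on [[0, 1]], then [w t <= B * t], so [U r - U 0] is at most [B * r * r] for
    [r <= 1]. *)
Let cvg_U : (U r - U 0) / r @[r --> 0^'+] --> 0.
Proof.
have [B HB] := bf.2 1.
have cB : B * r @[r --> 0^'+] --> 0.
  have : B * r @[r --> 0^'+] --> (B * 0 : R).
    apply: cvgM; first exact: cvg_cst.
    exact: cvg_at_right_filter cvg_id.
  by rewrite mulr0.
apply: cvg0_le_norm cB _; near=> r.
have r0 : 0 < r by near: r; exact: nbhs_right_gt.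
have r1 : r <= 1 by near: r; exact: nbhs_right_le.
rewrite /U /radial_potential (primitive_le0 _ (lexx 0)) addr0.
rewrite addrAC subrr add0r.
rewrite ger0_norm ?divr_ge0 ?(ltW r0) ?primitive_ge0// ler_pdivrMr//.
apply: (primitive_le_cst bw (ltW r0)) => t t0 tr.
have B0 : 0 <= B by have /andP[/le_trans + ?] := HB _ (lexx 0) ler01; apply.
apply: (@le_trans _ _ (B * t)); last by rewrite ler_wpM2l.
apply: (radial_mean_le_cst _ bf t0) => x x0 xt.
by have /andP[] := HB _ x0 (le_trans xt (le_trans tr r1)).
Unshelve. all: by end_near. Qed.

Lemma radial_poisson_C2 :
  C2 (fun y : 'rV[R]_N => radial_potential N.-1 f (enorm y)).
Proof. exact: (C2_radial dU dw continuous_w1 cvg_U cvg_w cvg_w1). Qed.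

Lemma radial_potential_gt0 r : 0 < radial_potential N.-1 f r.
Proof. by rewrite ltr_wpDr// primitive_ge0. Qed.

Lemma radial_poisson_laplacian (x : 'rV[R]_N) :
  laplacian (fun y : 'rV[R]_N => radial_potential N.-1 f (enorm y)) x =
  f (enorm x).
Proof.
have [/eqP|x0] := eqVneq (enorm x) 0.
  rewrite enorm_eq0 => /eqP ->.
  by rewrite (laplacian_radial0 dU cvg_U cvg_w) enorm0 f0.
rewrite (laplacian_radial dU dw x0) /w1 -subn1 natrB ?(ltnW N2)//.
by rewrite subrK.
Qed.

Lemma radial_poisson_grad (x : 'rV[R]_N) : enorm x != 0 ->
  enorm (grad (fun y : 'rV[R]_N => radial_potential N.-1 f (enorm y)) x) =
  radial_mean N.-1 f (enorm x).
Proof.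
move=> x0; rewrite (enorm_grad_radial dU x0) ger0_norm//.
exact: radial_mean_ge0.
Qed.

End radial_poisson.

(** * Existence in the sublinear case *)

(** Knaster-Tarski: the fixed point is the pointwise supremum of all [W] with [W <= Phi W]. Even an
    uncountable supremum of nondecreasing functions between [lo] and [hi] is of the same kind, so
    [P] is preserved. *)
Lemma monotone_fixpoint (R : realType) (Phi : (R -> R) -> R -> R)
    (lo hi : R -> R)
    (P := fun V : R -> R => {homo V : x y / x <= y} /\
                            forall t, lo t <= V t <= hi t) :
  P lo -> (forall V, P V -> P (Phi V)) ->
  (forall V W, P V -> P W -> (forall t, V t <= W t) ->
     forall t, Phi V t <= Phi W t) ->
  exists2 V, P V & forall t, V t = Phi V t.
Proof.
move=> Plo PPhi mono.
pose S : set (R -> R) := [set V | P V /\ forall t, V t <= Phi V t].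
have Slo : S lo by split => // t; have [_ /(_ t)/andP[]] := PPhi _ Plo.
pose V t := sup [set W t | W in S].
have leV W t : S W -> W t <= V t.
  move=> SW; apply: ub_le_sup; last by exists W.
  by exists (hi t) => _ [W' [[_ /(_ t)/andP[_ ?]] _] <-].
have Vle t c : (forall W, S W -> W t <= c) -> V t <= c.
  move=> Wc; apply: ge_sup; first by exists (lo t), lo.
  by move=> _ [W SW <-]; exact: Wc.
have PV : P V.
  split=> [x y xy|t].
    apply: Vle => W SW; apply: le_trans (leV _ _ SW).
    by case: SW => -[+ _] _; apply.
  rewrite leV//=; apply: Vle => W [[_ /(_ t)/andP[]]] //.
have VPhi t : V t <= Phi V t.
  apply: Vle => W SW; have [PW WPhi] := SW.
  by apply: le_trans (WPhi t) _; apply: mono => // x; exact: leV.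
(* [Phi V] itself belongs to [S], hence lies below the supremum [V]. *)
exists V => // t; apply: le_anti; rewrite VPhi/=; apply: leV.
split; first exact: PPhi.
by apply: mono => //; exact: PPhi.
Qed.

Lemma continuous_powR_gt0 (R : realType) (e t : R) : 0 < t ->
  {for t, continuous (fun x : R => x `^ e)}.
Proof.
move=> t0; apply/differentiable_continuous/derivable1_diffP.
by apply: derivable_powR; rewrite in_itv/= t0.
Qed.

(** Zeros of [g] are the delicate points, as the power need not be differentiable there;
    [g <= d^(1/e)] gives [g^e <= d]. This serves for [u'], known only to be nonnegative. *)
Lemma continuous_powR_ge0 (R : realType) (g : R -> R) (e r : R) : 0 < e ->
  (forall t, 0 <= g t) -> {for r, continuous g} ->
  {for r, continuous (fun t => g t `^ e)}.
Proof.
move=> e0 g0 cg; have := g0 r; rewrite le_eqVlt => /predU1P[gr|gr]; last first.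
  apply: (@continuous_comp _ _ _ g (fun x => x `^ e)); first exact: cg.
  exact: continuous_powR_gt0.
rewrite /prop_for /continuous_at -gr powR0 ?gt_eqF//.
have g_0 : g @ r --> 0 by rewrite gr.
apply/cvgr0Pnorm_le => d d0.
have d1 : 0 < d `^ e^-1 by rewrite powR_gt0.
move/cvgr0Pnorm_le : g_0 => /(_ _ d1); apply: filterS => t.
rewrite !ger0_norm ?powR_ge0// => gt.
rewrite -(powRr1 (ltW d0)) -(mulVf (lt0r_neq0 e0)) powRrM.
by rewrite ge0_ler_powR ?nnegrE ?(ltW e0) ?powR_ge0.
Qed.

(** * The upper barrier *)

Section upper_solution_theory.
Context {R : realType} (m : R).
Hypothesis m0 : 0 < m.

(** The solution of [M' = t^m M], [M 0 = 1]. At negative [t] the real power takes a default value,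
    and only [1 <= M] matters there. *)
Definition upper_solution (t : R) := expR (t `^ (m + 1) / (m + 1)).

Let m1 : 0 < m + 1.
Proof. by rewrite addr_gt0. Qed.

Lemma upper_solution_ge1 t : 1 <= upper_solution t.
Proof. by rewrite -expR0 ler_expR divr_ge0 ?powR_ge0 ?(ltW m1). Qed.

Lemma upper_solution_ndecr t r : 0 <= t -> t <= r ->
  upper_solution t <= upper_solution r.
Proof.
move=> t0 tr; rewrite ler_expR ler_pM2r ?invr_gt0//.
by rewrite ge0_ler_powR ?nnegrE ?(ltW m1)// (le_trans t0).
Qed.

Lemma loc_bounded_upper_solution : loc_bounded_ge0 upper_solution.
Proof.
split.
  apply: measurableT_comp; first exact: measurable_expR.
  apply: measurable_funM; first exact: measurable_powR.
  exact: measurable_cst.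
move=> r; exists (upper_solution r) => t t0 tr.
by rewrite expR_ge0/= upper_solution_ndecr.
Qed.

Lemma is_derive_upper_solution (t : R) : 0 < t ->
  is_derive t 1 upper_solution (t `^ m * upper_solution t).
Proof.
move=> t0.
have dp : is_derive t 1 (fun x : R => x `^ (m + 1)) ((m + 1) * t `^ m).
  by have := is_derive1_powR (m + 1) t0; rewrite addrK.
have dq : is_derive t 1 (fun x : R => x `^ (m + 1) / (m + 1)) (t `^ m).
  apply: is_derive_eq; rewrite /GRing.scale/=.
  by field; rewrite gt_eqF.
rewrite mulrC.
exact: (@is_derive1_comp _ expR _ _ _ _ (is_derive_expR _) dq).
Qed.

Lemma cvg_upper_solution0 : upper_solution t @[t --> 0^'+] --> (1 : R).
Proof.
rewrite -expR0; apply: (@cvg_comp _ _ _ _ expR _ (nbhs (0 : R))).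
  have : t `^ (m + 1) / (m + 1) @[t --> 0^'+] --> (0 / (m + 1) : R).
    by apply: cvgM; [exact: powR_cvg0|exact: cvg_cst].
  by rewrite mul0r.
exact: continuous_expR.
Qed.

Lemma primitive_upper_solution (r : R) : 0 < r ->
  primitive (fun t => t `^ m * upper_solution t) r = upper_solution r - 1.
Proof.
move=> r0.
have M0 : upper_solution 0 = 1.
  by rewrite /upper_solution powR0 ?gt_eqF// mul0r expR0.
have cM (t : R) : 0 < t -> {for t, continuous upper_solution}.
  by move=> t0; exact: derive_continuous_at (is_derive_upper_solution t0).
have cg (t : R) : 0 < t ->
    {for t, continuous (fun x => x `^ m * upper_solution x)}.
  by move=> t0; apply: continuousM; [exact: continuous_powR_gt0|exact: cM].
have itv (t : R) : t \in `]0, r[ -> 0 < t by rewrite in_itv/= => /andP[].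
(* Differentiability holds only for [t > 0]; at the endpoint 0 one-sided limits take its place. *)
rewrite /primitive /Rintegral (@continuous_FTC2 _ _ upper_solution)//.
- by rewrite M0.
- apply/(continuous_within_itvP _ r0); split.
  + by move=> t /itv; exact: cg.
  + rewrite powR0 ?gt_eqF// mul0r.
    have : t `^ m * upper_solution t @[t --> 0^'+] --> (0 * 1 : R).
      by apply: cvgM; [exact: powR_cvg0|exact: cvg_upper_solution0].
    by rewrite mul0r.
  + exact/cvg_at_left_filter/cg.
- split.
  + by move=> t /itv /is_derive_upper_solution[].
  + by rewrite M0; exact: cvg_upper_solution0.
  + exact/cvg_at_left_filter/cM.
- by move=> t /itv /is_derive_upper_solution[_ dE]; rewrite derive1E.
Qed.

End upper_solution_theory.

(** * The integral operator and its fixed point *)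

Section existence.
Context {R : realType} (N : nat) (a b p q s : R).
Hypothesis N2 : (2 <= N)%N.
Hypothesis a0 : 0 < a.
Hypothesis b0 : 0 < b.
Hypothesis p0 : 0 < p.
Hypothesis q0 : 0 < q.
Hypothesis s0 : 0 < s.
Hypothesis pqs : p * s + q <= 1.

(** The power of [r] in the bound on [slope_v]: [b] from the weight, [s (a + 1)] from the bound on
    [slope_u], 1 from the outer radial mean. *)
Let m := b + s * (a + 1) + 1.
(** A given [V] determines [u'] by the first equation, and the second involves [u] only through
    [u']: the system reduces to [V = Phi V]. *)
Let source_u (V : R -> R) (t : R) := t `^ a * V t `^ p.
Let slope_u (V : R -> R) := radial_mean N.-1 (source_u V).
Let source_v (V : R -> R) (t : R) := t `^ b * V t `^ q * slope_u V t `^ s.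
Let slope_v (V : R -> R) := radial_mean N.-1 (source_v V).
Let Phi (V : R -> R) := radial_potential N.-1 (source_v V).
Let admissible (V : R -> R) := {homo V : x y / x <= y} /\
  forall t, 1 <= V t <= upper_solution m t.

Let m0 : 0 < m.
Proof. by rewrite !addr_gt0// mulr_gt0// addr_gt0. Qed.

Let bV V : admissible V -> loc_bounded_ge0 V.
Proof.
move=> [ndV VM]; split; first exact: nondecreasing_measurable.
move=> r; exists (V r) => t t0 tr; rewrite ndV// andbT.
by have /andP[+ _] := VM t; apply: le_trans.
Qed.

Let bsu V : admissible V -> loc_bounded_ge0 (source_u V).
Proof.
move=> aV; apply: loc_boundedM; apply: loc_bounded_powR; rewrite ?ltW//.
  exact: loc_bounded_id.
exact: bV.
Qed.

Let bwu V : admissible V -> loc_bounded_ge0 (slope_u V).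
Proof. by move=> aV; exact/loc_bounded_radial_mean/bsu. Qed.

Let bsv V : admissible V -> loc_bounded_ge0 (source_v V).
Proof.
move=> aV; apply: loc_boundedM; last first.
  by apply: loc_bounded_powR; [exact: ltW|exact: bwu].
apply: loc_boundedM; apply: loc_bounded_powR; rewrite ?ltW//.
  exact: loc_bounded_id.
exact: bV.
Qed.

Let bwv V : admissible V -> loc_bounded_ge0 (slope_v V).
Proof. by move=> aV; exact/loc_bounded_radial_mean/bsv. Qed.

Let V_gt0 V t : admissible V -> 0 < V t.
Proof. by move=> [_ /(_ t)/andP[V1 _]]; exact: lt_le_trans V1. Qed.

Let slope_u_le V t r : admissible V -> 0 <= t -> t <= r ->
  slope_u V t <= r `^ (a + 1) * upper_solution m r `^ p.
Proof.
move=> aV t0 tr; have r0 : 0 <= r by exact: le_trans tr.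
apply: (@le_trans _ _ (r `^ a * upper_solution m r `^ p * t)).
  apply: (radial_mean_le_cst _ (bsu aV) t0) => x x0 xt.
  have xr := le_trans xt tr.
  apply: ler_pM; rewrite ?powR_ge0//.
    by rewrite ge0_ler_powR ?nnegrE// ltW.
  rewrite ge0_ler_powR ?nnegrE ?(ltW p0) ?(ltW (V_gt0 _ aV)) ?expR_ge0//.
  have [ndV /(_ r)/andP[_]] := aV; apply: le_trans; exact: ndV.
rewrite (_ : r `^ (a + 1) = r `^ a * r); last first.
  by rewrite powRD ?powRr1// gt_eqF// addr_gt0.
by rewrite mulrAC ler_wpM2r ?powR_ge0// ler_wpM2l ?powR_ge0.
Qed.

(** Bounding every factor of the source on [[0, r]] by its bound at [r] gives [r^m M^(q + p s)]. *)
Let slope_v_le V r : admissible V -> 0 <= r ->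
  slope_v V r <= r `^ m * upper_solution m r.
Proof.
move=> aV r0; pose M := upper_solution m r.
have M1 : 1 <= M by exact: upper_solution_ge1.
have M0 : 0 < M by exact: expR_gt0.
apply: (@le_trans _ _ (r `^ b * M `^ q * (r `^ (a + 1) * M `^ p) `^ s * r)).
  apply: (radial_mean_le_cst _ (bsv aV) r0) => t t0 tr.
  apply: ler_pM; rewrite ?mulr_ge0 ?powR_ge0//.
    apply: ler_pM; rewrite ?powR_ge0//.
      by rewrite ge0_ler_powR ?nnegrE// ltW.
    rewrite ge0_ler_powR ?nnegrE ?(ltW q0) ?(ltW (V_gt0 _ aV)) ?(ltW M0)//.
    have [ndV /(_ r)/andP[_]] := aV; apply: le_trans; exact: ndV.
  have wt0 : 0 <= slope_u V t by exact: loc_bounded_ge0_itv (bwu aV) t0.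
  apply: ge0_ler_powR; rewrite ?nnegrE ?(ltW s0)//; last exact: slope_u_le.
  by rewrite mulr_ge0 ?powR_ge0.
rewrite powRM ?powR_ge0// -!powRrM.
have -> : r `^ m = r `^ b * r `^ ((a + 1) * s) * r.
  rewrite -powRD; last by rewrite gt_eqF// addr_gt0// mulr_gt0// addr_gt0.
  rewrite -[X in _ * X]powRr1// -powRD; last by rewrite gt_eqF// mulrC.
  by rewrite [(a + 1) * s]mulrC.
(* Sublinearity enters here: [M >= 1] and the total exponent is at most 1. *)
have MM : M `^ q * M `^ (p * s) <= M.
  rewrite -powRD ?(gt_eqF M0) ?implybT//.
  by rewrite ler1_powR// addrC.
rewrite (_ : _ * r = r `^ b * r `^ ((a + 1) * s) * r * (M `^ q * M `^ (p * s)));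
  last by ring.
by rewrite ler_wpM2l// !mulr_ge0 ?powR_ge0.
Qed.

Let admissible1 : admissible (fun=> 1).
Proof. by split => // t; rewrite lexx upper_solution_ge1. Qed.

(** For [t > 0], integrating [slope_v V <= r^m M = M'] from 0 gives [Phi V <= 1 + (M - 1)]; for
    [t <= 0] the value is 1. *)
Let admissible_Phi V : admissible V -> admissible (Phi V).
Proof.
move=> aV; have bz := bwv aV; split=> [x y xy|t].
  by rewrite lerD2l; exact: primitive_ndecr.
rewrite lerDl primitive_ge0//=.
have [t0|t0] := leP t 0.
  by rewrite /Phi /radial_potential primitive_le0// addr0 upper_solution_ge1.
rewrite -lerBrDl -(primitive_upper_solution m0 t0).
apply: le_primitive; first exact: bz.
- apply: loc_boundedM; last exact: loc_bounded_upper_solution.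
  by apply: loc_bounded_powR; [exact: ltW|exact: loc_bounded_id].
- by move=> r r0 _; exact: slope_v_le.
Qed.

Let Phi_mono V W : admissible V -> admissible W -> (forall t, V t <= W t) ->
  forall t, Phi V t <= Phi W t.
Proof.
move=> aV aW VW t; rewrite lerD2l.
apply: le_primitive => [||r r0 _]; [exact: bwv|exact: bwv|].
have le_pow (e x : R) : 0 < e -> V x `^ e <= W x `^ e.
  by move=> e0; rewrite ge0_ler_powR ?nnegrE ?(ltW e0) ?(ltW (V_gt0 _ _)).
have slope_le x : slope_u V x <= slope_u W x.
  apply: le_radial_mean => [||y y0 _]; [exact: bsu|exact: bsu|].
  by rewrite /source_u ler_wpM2l ?powR_ge0 ?le_pow.
apply: le_radial_mean => [||x x0 _]; [exact: bsv|exact: bsv|].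
rewrite /source_v; apply: ler_pM; last first.
- apply: ge0_ler_powR; rewrite ?nnegrE ?(ltW s0)//.
  + exact: loc_bounded_ge0_itv (bwu aV) x0.
  + exact: loc_bounded_ge0_itv (bwu aW) x0.
- by rewrite ler_wpM2l ?powR_ge0 ?le_pow.
- exact: powR_ge0.
- exact: mulr_ge0 (powR_ge0 _ _) (powR_ge0 _ _).
Qed.

Lemma radial_solution_exists :
  exists u v : 'rV[R]_N -> R, positive_radial_solution a b p q s u v.
Proof.
have [V aV VPhi] := monotone_fixpoint admissible1 admissible_Phi Phi_mono.
have VE : V = Phi V by apply/funext.
have VR t : radial_potential N.-1 (source_v V) t = V t by exact/esym/VPhi.
(* Bootstrapping: being 1 plus an integral, the monotone fixed point is continuous, hence so are
   both sources. *)
have cV (r : R) : 0 < r -> {for r, continuous V}.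
  move=> r0; rewrite VE.
  have ck : {for r, continuous (fun _ : R => 1 : R)} by exact: cst_continuous.
  exact: (continuousD ck (continuous_primitive (bwv aV) r0)).
have V1 t : t <= 1 -> V t <= V 1 by case: aV => + _; apply.
have pow0 (e C : R) : 0 < e -> t `^ e * C @[t --> 0^'+] --> (0 : R).
  move=> e0; have : t `^ e * C @[t --> 0^'+] --> (0 * C : R).
    by apply: cvgM; [exact: powR_cvg0|exact: cvg_cst].
  by rewrite mul0r.
have csu (r : R) : 0 < r -> {for r, continuous (source_u V)}.
  move=> r0; apply: continuousM; first exact: continuous_powR_gt0.
  by apply: continuous_powR_ge0 => [//|t|]; [exact/ltW/V_gt0|exact: cV].
(* Near 0, [V] is bounded by [V 1], so the weight [t^a] forces the limit 0. *)
have limsu : source_u V r @[r --> 0^'+] --> 0.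
  apply: cvg0_le_norm (pow0 a (V 1 `^ p) a0) _; near=> t.
  rewrite ger0_norm ?mulr_ge0 ?powR_ge0// ler_wpM2l ?powR_ge0//.
  rewrite ge0_ler_powR ?nnegrE ?(ltW p0) ?(ltW (V_gt0 _ aV))// V1//.
  by near: t; exact: nbhs_right_le.
have su0 : source_u V 0 = 0 by rewrite /source_u powR0 ?gt_eqF// mul0r.
have n0 : (0 < N.-1)%N by rewrite -subn1 subn_gt0.
have csv (r : R) : 0 < r -> {for r, continuous (source_v V)}.
  move=> r0; apply: continuousM.
    apply: continuousM; first exact: continuous_powR_gt0.
    by apply: continuous_powR_ge0 => [//|t|]; [exact/ltW/V_gt0|exact: cV].
  have cw := derive_continuous_at
    (is_derive_radial_mean n0 (bsu aV) r0 (csu _ r0)).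
  apply: continuous_powR_ge0 => // t; exact: radial_mean_ge0 (bsu aV).
have limsv : source_v V r @[r --> 0^'+] --> 0.
  have [B HB] := (bwu aV).2 1.
  apply: cvg0_le_norm (pow0 b (V 1 `^ q * B `^ s) b0) _; near=> t.
  have t0 : 0 <= t by apply: ltW; near: t; exact: nbhs_right_gt.
  have t1 : t <= 1 by near: t; exact: nbhs_right_le.
  have /andP[w0 wB] := HB _ t0 t1.
  rewrite ger0_norm ?mulr_ge0 ?powR_ge0// /source_v -mulrA.
  rewrite ler_wpM2l ?powR_ge0// ler_pM ?powR_ge0//.
    by rewrite ge0_ler_powR ?nnegrE ?(ltW q0) ?(ltW (V_gt0 _ aV))// V1.
  by rewrite ge0_ler_powR ?nnegrE ?(ltW s0)// (le_trans w0).
have sv0 : source_v V 0 = 0 by rewrite /source_v powR0 ?gt_eqF// !mul0r.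
exists (fun x => radial_potential N.-1 (source_u V) (enorm x)).
(* The profile is [V] by [VR], but in this form the Poisson lemmas apply to it directly. *)
exists (fun x => radial_potential N.-1 (source_v V) (enorm x)).
split.
- split.
  + exact: (radial_poisson_C2 N2 (bsu aV) csu su0 limsu).
  + exact: (radial_poisson_C2 N2 (bsv aV) csv sv0 limsv).
- by split=> x; apply: radial_potential_gt0; [exact: bsu|exact: bsv].
- by split=> x y xy; rewrite xy.
move=> x; split.
  apply: (etrans (radial_poisson_laplacian N2 (bsu aV) csu su0 limsu x)).
  by rewrite VR.
apply: (etrans (radial_poisson_laplacian N2 (bsv aV) csv sv0 limsv x)).
rewrite VR.
(* The gradient formula holds off the origin; at the origin both sides vanish because [b > 0]. *)
have [x0|x0] := eqVneq (enorm x) 0.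
  by rewrite x0 sv0 powR0 ?gt_eqF// !mul0r.
by congr (_ * _ `^ s); exact/esym/(radial_poisson_grad N2 (bsu aV) csu x0).
Unshelve. all: by end_near. Qed.

End existence.

Theorem theorem2p2 (R : realType) (N : nat) (a b p q s : R)
    (hN : (2 <= N)%N) (ha : 0 < a) (hb : 0 < b) (hp : 0 < p) (hq : 0 < q)
    (hs : 1 <= s) :
  (exists u v : 'rV[R]_N -> R, positive_radial_solution a b p q s u v) <->
  p * s + q - 1 <= 0.
Proof.
have s0 : 0 < s by exact: lt_le_trans hs.
split=> [[u [v uv]]|pqs].
  exact: radial_solution_exponents hN ha hb hp hq s0 uv.
by apply: radial_solution_exists => //; rewrite -subr_le0.
Qed.
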